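(* Let $G$ be a finite simple graph with vertex set $V(G)=\{v_1,\ldots,v_n\}$. The following conditions are equivalent: 1. $G$ is $1$-perfectly orientable. 2. $G$ has an edge clique cover $\{C_1,\ldots,C_n\}$ such that (a) $v_i\in C_i$ for all $i$, and (b) for every edge $v_iv_j\in E(G)$, we have $v_i\in C_j$ or $v_j\in C_i$, but not both. 3. $G$ has an edge clique cover $\{C_1,\ldots,C_n\}$ such that (a) $v_i\in C_i$ for all $i$, and (b) for every edge $v_iv_j\in E(G)$, we have $v_i\in C_j$ or $v_j\in C_i$.
   Context: All graphs are finite and simple. An orientation of a graph $G$ is $1$-perfect if for every vertex $v$, its out-neighborhood induces a tournament, i.e. is a clique in $G$. A graph is $1$-perfectly orientable if it admits a $1$-perfect orientation. An edge clique cover of $G$ is a collection of cliques of $G$ such that every edge of $G$ lies in at least one of them. *)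

(* Defs.v *)
From mathcomp Require Import all_boot.

Set Implicit Arguments.
Unset Strict Implicit.
Unset Printing Implicit Defensive.

Record sgraph := SGraph {
  vertex :> finType;
  adj : rel vertex;
  adj_sym : symmetric adj;
  adj_irrefl : irreflexive adj
}.

Definition clique (G : sgraph) (S : {set G}) : Prop :=
  {in S &, forall x y : G, x != y -> adj x y}.

(* [d x y] means that the edge xy is directed from x to y. *)
Definition orientation (G : sgraph) (d : rel G) : Prop :=
  (forall x y : G, d x y -> adj x y) /\
  (forall x y : G, adj x y -> d x y (+) d y x).

Definition out_nbhd (T : finType) (d : rel T) (x : T) : {set T} :=
  [set y | d x y].

Definition induces_tournament (T : finType) (d : rel T) (S : {set T}) : Prop :=
  {in S, forall x, ~~ d x x} /\
  {in S &, forall x y, x != y -> d x y (+) d y x}.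

Lemma induces_tournamentE (G : sgraph) (d : rel G) (S : {set G}) :
  orientation d -> induces_tournament d S <-> clique S.
Proof.
move=> [dE Ed]; split=> [[_ tS] x y xS yS xy|cS].
  have := tS x y xS yS xy; case dxy: (d x y) => /=; first by rewrite dE.
  by rewrite adj_sym; apply: dE.
split=> [x xS|x y xS yS xy]; last by apply: Ed; apply: cS.
by apply/negP => /dE; rewrite adj_irrefl.
Qed.

Definition one_perfect (G : sgraph) (d : rel G) : Prop :=
  orientation d /\ forall x : G, induces_tournament d (out_nbhd d x).

Definition one_perfectly_orientable (G : sgraph) : Prop :=
  exists d : rel G, one_perfect d.

(* The collection is an indexed family, so repeated cliques are allowed. *)
Definition edge_clique_cover (G : sgraph) (I : Type) (C : I -> {set G}) : Prop :=
  (forall i, clique (C i)) /\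
  (forall x y : G, adj x y -> exists i, x \in C i /\ y \in C i).

(* Main.v *)
Require Import Defs.
From mathcomp Require Import all_boot.

(** A 1-perfect orientation yields the cover by closed out-neighbourhoods
    [C_i = {v_i} + N^+(v_i)].  Conversely, given a cover as in condition 3,
    direct each edge from [x] to [y] when [y] lies in the clique of [x],
    breaking ties by a linear order on the vertices: every out-neighbourhood
    is then contained in a clique. *)

Lemma clique_sub {G : sgraph} {A B : {set G}} :
  A \subset B -> clique B -> clique A.
Proof. by move=> /subsetP sAB cB x y /sAB xB /sAB yB; apply: cB. Qed.

(** The vertex [x] is adjacent to all its out-neighbours, and these are pairwise adjacent because
    they induce a tournament. *)
Lemma one_perfect_closed_out_nbhd (G : sgraph) (d : rel G) (x : G) :
  one_perfect d -> clique (x |: out_nbhd d x).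
Proof.
move=> [od td] y z.
have /(induces_tournamentE _ od) cx := td x.
have [dE _] := od.
rewrite !in_setU1 => /predU1P[->|yx] /predU1P[->|zx] yz.
- by rewrite eqxx in yz.
- by apply: dE; rewrite inE in zx.
- by rewrite adj_sym; apply: dE; rewrite inE in yx.
- exact: cx.
Qed.

Lemma one_perfectly_orientable_cliques (G : sgraph) (C : G -> {set G}) :
  (forall x, clique (C x)) ->
  (forall x y, adj x y -> x \in C y \/ y \in C x) ->
  one_perfectly_orientable G.
Proof.
move=> cC adjC.
(* The ranks are compared only when each endpoint lies in the clique of the other; otherwise the
   implication is vacuous and membership alone fixes the direction. *)
pose d : rel G := fun x y =>
  [&& adj x y, y \in C x & (x \in C y) ==> (enum_rank x < enum_rank y)].
have od : orientation d.
  split=> [x y /and3P[]//|x y xy].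
  have neq_xy : enum_rank x != enum_rank y :> nat.
    by apply: contraL xy => /eqP/val_inj/enum_rank_inj->; rewrite adj_irrefl.
  rewrite /d xy [adj y x]adj_sym xy /=.
  (* One membership holds. If the other fails, the direction is forced; if it holds too, the
     distinct ranks select exactly one direction. *)
  case: (adjC _ _ xy) => ->; rewrite ?andbT /=; [case: (y \in C x)|case: (x \in C y)];
    by move: neq_xy => //=; case: ltngtP.
exists d; split=> // x; apply/(induces_tournamentE _ od).
by apply: clique_sub (cC x); apply/subsetP => y; rewrite inE => /and3P[].
Qed.

Theorem theorem3 (G : sgraph) (n : nat) (v : 'I_n -> G) (v_bij : bijective v) :
  (one_perfectly_orientable G <->
   exists C : 'I_n -> {set G},
     edge_clique_cover C /\
     (forall i : 'I_n, v i \in C i) /\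
     (forall i j : 'I_n, adj (v i) (v j) ->
        (v i \in C j \/ v j \in C i) /\ ~ (v i \in C j /\ v j \in C i)))
  /\
  ((exists C : 'I_n -> {set G},
     edge_clique_cover C /\
     (forall i : 'I_n, v i \in C i) /\
     (forall i j : 'I_n, adj (v i) (v j) ->
        (v i \in C j \/ v j \in C i) /\ ~ (v i \in C j /\ v j \in C i))) <->
   exists C : 'I_n -> {set G},
     edge_clique_cover C /\
     (forall i : 'I_n, v i \in C i) /\
     (forall i j : 'I_n, adj (v i) (v j) ->
        v i \in C j \/ v j \in C i)).
Proof.
have [w vK wK] := v_bij.
set P1 := one_perfectly_orientable G.
set P2 := (X in P1 <-> X); set P3 := (X in _ /\ (_ <-> X)).
have P12 : P1 -> P2.
  move=> [d pd]; have [[dE Ed] _] := pd.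
  (* Adjacent vertices are distinct, so membership in the closed out-neighbourhood amounts to an
     arc. Condition (b) thus becomes the exclusive or in [Ed]. *)
  have memC i j : adj (v i) (v j) ->
      (v i \in v j |: out_nbhd d (v j)) = d (v j) (v i).
    move=> ij; rewrite in_setU1 inE.
    by case: eqP ij => // ->; rewrite adj_irrefl.
  exists (fun i => v i |: out_nbhd d (v i)); split; [split|split].
  - by move=> i; apply: one_perfect_closed_out_nbhd.
  - move=> x y xy; have := Ed _ _ xy.
    (* Each edge is covered by the clique of its tail. *)
    case dxy: (d x y) => /= dyx; [exists (w x)|exists (w y)];
      by rewrite wK !inE ?eqxx ?dxy ?dyx ?orbT.
  - by move=> i; rewrite setU11.
  - move=> i j ij; rewrite (memC _ _ ij) memC 1?adj_sym //.
    have := Ed _ _ ij.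
    by case: (d (v i) (v j)); case: (d (v j) (v i)) => //= _;
      split; [right| case | left | case].
have P23 : P2 -> P3.
  move=> [C [eC [vC adjC]]]; exists C; split=> //; split=> // i j ij.
  by have [] := adjC i j ij.
have P31 : P3 -> P1.
  move=> [C [[cC _] [_ adjC]]].
  (* Composing with the inverse [w] of [v] reindexes the cliques by vertices. *)
  apply: (@one_perfectly_orientable_cliques G (C \o w)) => [x|x y xy] /=.
    exact: cC.
  by have := adjC (w x) (w y); rewrite !wK; apply.
split; split.
- exact: P12.
- by move=> p2; apply/P31/P23.
- exact: P23.
- by move=> p3; apply/P12/P31.
Qed.
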